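(* (1) Let $q=p_1^{k_1}p_2^{k_2}$ with $p_1,p_2$ distinct primes and $k_1,k_2\geq1$, and let $N\geq 1$. A dephased matrix $H\in M_{2\times N}(\mathbb Z_q)$ with multiplicity matrix $A\in M_{p_1^{k_1}\times p_2^{k_2}}(\mathbb N)$, written with double indices $A_{ij,xy}$ where $i\in\mathbb Z_{p_1}$, $j\in\mathbb Z_{p_1^{k_1-1}}$, $x\in\mathbb Z_{p_2}$, $y\in\mathbb Z_{p_2^{k_2-1}}$, is partial Butson if and only if there exist $B_{ijy},C_{jxy}\in\mathbb N$ such that $$A_{ij,xy}=B_{ijy}+C_{jxy}\quad\text{for all } i,j,x,y.$$ Thus the dephased partial Butson matrices $H\in M_{2\times N}(\mathbb Z_q)$, up to permutation of the columns, are indexed by the matrices $A$ of this form whose entries sum to $N$. (2) In particular, for $q=2p$ with $p\geq3$ prime and any $N\geq1$, the probability $P_2$ for a uniformly random matrix $H\in M_{2\times N}(\mathbb Z_q)$ to be partial Butson equals the probability for a length $N$ simple random walk on $\mathbb Z^p$, started at the origin, to end up on the diagonal, i.e. at a position of type $(t,\ldots,t)$ with $t\in\mathbb Z$.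
   Context: $\mathbb N=\{0,1,2,\ldots\}$. As a set of matrix entries, $\mathbb Z_q\subset\mathbb C^\times$ denotes the multiplicative group of complex $q$-th roots of unity, and $M_{M\times N}(\mathbb Z_q)$ is the set of $M\times N$ matrices with all entries in it. (When used for index sets, $\mathbb Z_m$ is just identified with $\{0,1,\ldots,m-1\}$.) A matrix $H\in M_{M\times N}(\mathbb Z_q)$ is partial Butson if its rows are pairwise orthogonal in $\mathbb C^N$ with the usual Hermitian scalar product. It is dephased if its first row consists of $1$ entries only. Multiplicity matrix: every $q$-th root of unity is uniquely a product $\alpha\beta$ with $\alpha^{p_1^{k_1}}=1$ and $\beta^{p_2^{k_2}}=1$. Write $\alpha=e^{2\pi \mathrm{i}(j+p_1^{k_1-1}i)/p_1^{k_1}}$ and $\beta=e^{2\pi \mathrm{i}(y+p_2^{k_2-1}x)/p_2^{k_2}}$ with $0\leq i<p_1$, $0\leq j<p_1^{k_1-1}$, $0\leq x<p_2$, $0\leq y<p_2^{k_2-1}$ (here the upright $\mathrm{i}$ is the imaginary unit). For a dephased $H\in M_{2\times N}(\mathbb Z_q)$, $A_{ij,xy}$ is the number of entries of its second row equal to the root $\alpha\beta$ indexed by $(i,j,x,y)$. The simple random walk on $\mathbb Z^p$ makes at each step, independently, one of the $2p$ moves $\pm e_1,\ldots,\pm e_p$ with equal probability $\frac{1}{2p}$, where $e_1,\dots,e_p$ is the standard basis. *)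

(* Defs.v *)
From mathcomp Require Import all_boot all_order all_algebra all_fingroup.
From mathcomp Require Import finmap.
From mathcomp Require Import all_classical all_reals all_analysis.
From mathcomp Require Import complex.

Set Implicit Arguments.
Unset Strict Implicit.
Unset Printing Implicit Defensive.

Import Order.TTheory GRing.Theory Num.Theory.
Local Open Scope classical_set_scope.
Local Open Scope complex_scope.
Local Open Scope ring_scope.

Definition expi (R : realType) (t : R) : R[i] := Complex (cos t) (sin t).

Definition root_matrix (R : realType) (q M N : nat) : set 'M[R[i]]_(M, N) :=
  [set H | H \is a mxOver q.-unity_root].

(* dotmx is the Hermitian product u *m (conjugate transpose of v) *)
Definition partial_butson (R : realType) (q M N : nat) :
    set 'M[R[i]]_(M, N) :=
  [set H | root_matrix q H /\
    forall i i' : 'I_M, i != i' -> dotmx (row i H) (row i' H) = 0].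

Definition dephased (R : realType) (M N : nat) : set 'M[R[i]]_(M.+1, N) :=
  [set H | forall c, H ord0 c = 1].

Definition column_equiv (R : realType) (M N : nat) (H H' : 'M[R[i]]_(M, N)) :=
  exists s : 'S_N, H' = col_perm s H.

Definition indexed_root (R : realType) (p k : nat)
    (a : 'I_p * 'I_(p ^ k.-1)) : R[i] :=
  let: (i, j) := a in expi (2 * pi * (j + p ^ k.-1 * i)%:R / (p ^ k)%:R).

(* p1 ^ k1 x p2 ^ k2 matrices over nat with entries A ((i, j), (x, y)); the
   double indices are kept as pairs instead of being flattened. *)
Definition mult_matrix (p1 k1 p2 k2 : nat) : Type :=
  {ffun ('I_p1 * 'I_(p1 ^ k1.-1)) * ('I_p2 * 'I_(p2 ^ k2.-1)) -> nat}.

Definition multiplicity (R : realType) (p1 k1 p2 k2 N : nat)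
    (H : 'M[R[i]]_(2, N)) : mult_matrix p1 k1 p2 k2 :=
  [ffun a => #|[set c : 'I_N |
     H ord_max c == indexed_root R a.1 * indexed_root R a.2]%SET|].

Definition decomposable (p1 k1 p2 k2 : nat) (A : mult_matrix p1 k1 p2 k2) :=
  exists (B : 'I_p1 -> 'I_(p1 ^ k1.-1) -> 'I_(p2 ^ k2.-1) -> nat)
         (C : 'I_(p1 ^ k1.-1) -> 'I_p2 -> 'I_(p2 ^ k2.-1) -> nat),
  forall (i : 'I_p1) (j : 'I_(p1 ^ k1.-1)) (x : 'I_p2)
         (y : 'I_(p2 ^ k2.-1)), A ((i, j), (x, y)) = (B i j y + C j x y)%N.

(* f induces a bijection from the E-classes of elements of P onto Q. *)
Definition indexes_classes (T I : Type) (P : set T) (E : T -> T -> Prop)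
    (f : T -> I) (Q : set I) :=
  [/\ forall x, P x -> Q (f x),
      forall x y, P x -> P y -> (E x y <-> f x = f y) &
      forall a, Q a -> exists2 x, P x & f x = a].

(* Probability of E under the uniform law on Omega; meaningful when Omega is
   finite and nonempty (fset_set sends infinite sets to the empty fset). *)
Definition uniform_proba (R : realType) (T : choiceType) (Omega E : set T) : R :=
  #|` fset_set (Omega `&` E)|%:R / #|` fset_set Omega|%:R.

Definition walk_step (p : nat) (m : bool * 'I_p) : 'rV[int]_p :=
  (-1) ^+ m.1 *: delta_mx 0 m.2.

(* Probability that the N-step simple random walk on Z^p started at the origin
   ends up in E: by independence, each sequence s of N moves has probability
   equal to the product of the probabilities 1 / (2 p) of its moves. *)
Definition walk_proba (R : realType) (p N : nat) (E : set 'rV[int]_p) : R :=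
  \sum_(s : {ffun 'I_N -> bool * 'I_p} | (\sum_(t < N) walk_step (s t)) \in E)
    \prod_(t < N) (2 * p)%:R^-1.

Definition diagonal_points (p : nat) : set 'rV[int]_p :=
  [set v | exists t : int, v = const_mx t].

(* Main.v *)
Require Import Defs.
From mathcomp Require Import all_boot all_order all_algebra all_fingroup.
From mathcomp Require Import all_field.
From mathcomp Require Import finmap.
From mathcomp Require Import all_classical all_reals all_analysis.
From mathcomp Require Import complex.
From mathcomp Require Import zify.

(* A dephased pair of rows is orthogonal iff the sum of the [A a] copies of each
   root [r a] vanishes. By irreducibility of the cyclotomic polynomial, the sum
   then also vanishes after raising the roots to any power [u] prime to [q]:
   the Fourier transform of [A] on [Z/q] is zero at the units. Taking a second
   difference of [A] along [Z/p1 x Z/p2] kills the remaining frequencies, which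
   are divisible by [p1] or [p2], so all these second differences are zero;
   this is the decomposition [B + C], made nonnegative by subtracting a minimum.
   For [q = 2p] the same criterion says that the numbers of steps [e_x] minus
   those of steps [- e_x], i.e. the coordinates of the walk with steps read off
   the roots [(-1)^b w^x], do not depend on [x]. *)

Set Implicit Arguments.
Unset Strict Implicit.
Unset Printing Implicit Defensive.

Import Order.TTheory GRing.Theory Num.Theory.
Local Open Scope classical_set_scope.
Local Open Scope complex_scope.
Local Open Scope ring_scope.

(** * Vanishing sums of roots of unity *)

(** [X^n - 1] is the product of the ['Phi_d] over [d | n], so [z] is a root of one of them; then
    [z ^+ d = 1], which forces [n | d]. *)
Lemma root_Cyclotomic (F : numFieldType) n (z : F) :
  n.-primitive_root z -> root (map_poly intr 'Phi_n) z.
Proof.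
move=> zP; have n0 := prim_order_gt0 zP.
have := congr1 (fun p : {poly int} => (map_poly intr p).[z] : F)
  (prod_Cyclotomic n0).
rewrite rmorphB /= map_polyXn rmorph1 !hornerE (prim_expr_order zP) subrr.
rewrite rmorph_prod horner_prod => /eqP.
rewrite prodf_seq_eq0 => /hasP[d dn /= dz].
move: dn; rewrite -dvdn_divisors // => dn.
have d0 : (0 < d)%N by apply: dvdn_gt0 dn.
suff -> : n = d by [].
apply/eqP; rewrite eqn_dvd dn andbT (prim_order_dvd zP).
have := congr1 (fun p : {poly int} => (map_poly intr p).[z] : F)
  (prod_Cyclotomic d0).
rewrite (big_rem d) /=; last by rewrite -dvdn_divisors.
rewrite rmorphM hornerM (eqP dz) mul0r.
rewrite rmorphB /= map_polyXn rmorph1 !hornerE => /esym/eqP.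
by rewrite subr_eq0.
Qed.

(** ['Phi_n] is irreducible over the rationals and vanishes at both [z] and [z'], so it divides [p]
    as soon as it shares the root [z] with it. *)
Lemma root_prim_root_conj (F : numFieldType) n (z z' : F) (p : {poly rat}) :
  n.-primitive_root z -> n.-primitive_root z' ->
  root (map_poly ratr p) z -> root (map_poly ratr p) z'.
Proof.
move=> zP z'P pz; have n0 := prim_order_gt0 zP.
(* Irreducibility comes from [algC], where ['Phi_n] is the minimal polynomial of a primitive root
   [x]. *)
have [x xP] := C_prim_root_exists n0.
pose f : {poly rat} := map_poly intr 'Phi_n.
have fE (L : numFieldType) : map_poly ratr f = map_poly intr 'Phi_n :> {poly L}.
  by rewrite -map_poly_comp; apply: eq_map_poly => m /=; rewrite ratr_int.
have [m [mE _] mP] := minCpolyP x.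
have fm : f = m.
  apply: (map_poly_inj (ratr : rat -> algC)).
  by rewrite fE -mE (minCpoly_cyclotomic xP) -(Cintr_Cyclotomic xP).
have fz : root (map_poly ratr f) z by rewrite fE root_Cyclotomic.
have fz' : root (map_poly ratr f) z' by rewrite fE root_Cyclotomic.
pose g := gcdp p f.
have gz : root (map_poly ratr g) z by rewrite gcdp_map root_gcd pz fz.
have f0 : f != 0 by rewrite monic_neq0 ?monic_map ?Cyclotomic_monic.
have g0 : g != 0 by rewrite gcdp_eq0 negb_and f0 orbT.
have sg : (1 < size g)%N.
  have := root_size_gt1 _ gz; rewrite map_poly_eq0 size_map_poly; exact.
have /dvdpP[h fE'] : g %| f by apply: dvdp_gcdr.
have h0 : h != 0 by apply: contraNneq f0 => h0; rewrite fE' h0 mul0r.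
(* [x] is a root of [g] or of the cofactor [h], whose degree is too small; so [f] divides [g]. *)
have : root (map_poly ratr f) x by rewrite fm mP.
rewrite fE' rmorphM /= rootM orbC !mP -fm => /orP[fg|fh]; last first.
  have := dvdp_leq h0 fh; rewrite fE' size_mul // -(prednK (ltnW sg)) addnS /=.
  by rewrite -subn1 -[X in (_ <= X)%N]addn0 leq_add2l leqn0 subn_eq0 leqNgt sg.
have /dvdpP[k ->] : f %| p by apply: dvdp_trans fg (dvdp_gcdl _ _).
by rewrite rmorphM rootM fz' orbT.
Qed.

(** With [r a = z ^+ e a], the sum is the value at [z] of a rational polynomial, which also vanishes
    at the conjugate [z ^+ u]. *)
Lemma vanishing_sum_conj (F : numFieldType) n (z : F) (I : finType)
    (A : I -> nat) (r : I -> F) u :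
  n.-primitive_root z -> (forall a, r a ^+ n = 1) -> coprime u n ->
  \sum_a r a *+ A a = 0 -> \sum_a r a ^+ u *+ A a = 0.
Proof.
move=> zP rn un; have /fin_all_exists[e re] : forall a, exists i : 'I_n, r a = z ^+ i.
  by move=> a; have [i ->] := prim_rootP zP (rn a); exists i.
pose p : {poly rat} := \sum_a 'X^(e a) *+ A a.
have pE y : (map_poly ratr p).[y] = \sum_a y ^+ e a *+ A a :> F.
  rewrite rmorph_sum horner_sum; apply: eq_bigr => a _.
  by rewrite rmorphMn /= map_polyXn hornerMn hornerXn.
under eq_bigr do rewrite re; rewrite -pE => /eqP/(root_prim_root_conj zP) pz.
under eq_bigr do rewrite re exprAC; rewrite -pE; apply/eqP/pz.
by rewrite prim_root_exp_coprime.
Qed.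

(** * Fourier inversion on roots of unity *)

Lemma unity_root_neq0 (F : fieldType) n (w : F) :
  (0 < n)%N -> w ^+ n = 1 -> w != 0.
Proof.
move=> n0 wn; apply: contra_eq_neq wn => ->.
by rewrite expr0n gtn_eqF // eq_sym oner_eq0.
Qed.

Lemma sum_expr_unity (F : fieldType) n (w : F) :
  w ^+ n = 1 -> w != 1 -> \sum_(u < n) w ^+ u = 0.
Proof.
move=> wn w1; apply: (mulfI (x := w - 1)); first by rewrite subr_eq0.
by rewrite -subrX1 wn subrr mulr0.
Qed.

(** After exchanging the sums, a term [a != b] carries the geometric sum of [r a / r b], a root of
    unity other than [1], and vanishes. *)
Lemma fourier_inversion (F : fieldType) n (I : finType) (r A : I -> F) b :
  injective r -> (forall a, r a ^+ n = 1) -> (0 < n)%N ->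
  A b *+ n = \sum_(u < n) (\sum_a A a * r a ^+ u) * (r b)^-1 ^+ u.
Proof.
move=> rI rn n0; have rb0 := unity_root_neq0 n0 (rn b).
under eq_bigr => u _ do rewrite mulr_suml.
rewrite exchange_big (bigD1 b) //= [X in _ + X]big1 ?addr0 => [|a ab].
  under eq_bigr => u _ do rewrite -mulrA -exprMn mulfV // expr1n mulr1.
  by rewrite sumr_const card_ord.
under eq_bigr => u _ do rewrite -mulrA -exprMn.
rewrite -mulr_sumr sum_expr_unity ?mulr0 //.
  by rewrite exprMn exprVn !rn invr1 mulr1.
by apply: contra ab => /eqP abE; apply/eqP/rI; rewrite -[LHS](mulfVK rb0) abE mul1r.
Qed.

(** Serves to cancel each of the two summands of a decomposed [A], which is constant along one coset
    index. *)
Lemma sum_mul_snd0 (F : fieldType) (I J : finType) (r : I * J -> F) (g : J -> F) :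
  (forall j, \sum_i r (i, j) = 0) -> \sum_a r a * g a.2 = 0.
Proof.
move=> r0; transitivity (\sum_i \sum_j r (i, j) * g j).
  by rewrite pair_bigA; apply: eq_bigr => -[].
by rewrite exchange_big big1 // => j _; rewrite -mulr_suml r0 mul0r.
Qed.

(** * Relations between products of roots of coprime prime power orders *)

Section TwoPrimes.
Variables (F : numFieldType) (p1 p2 k1 k2 : nat) (I1 J1 I2 J2 : finType).
Variables (r1 : I1 * J1 -> F) (r2 : I2 * J2 -> F).
Local Notation q := (p1 ^ k1 * p2 ^ k2)%N.
Hypotheses (p1P : prime p1) (p2P : prime p2) (p12 : p1 != p2).
Hypotheses (r1I : injective r1) (r2I : injective r2).
Hypotheses (r1q : forall a, r1 a ^+ (p1 ^ k1) = 1)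
           (r2q : forall a, r2 a ^+ (p2 ^ k2) = 1).
(** Roots with the same second index lie in one coset of the [p1]-th (resp. [p2]-th) roots of unity.
    The families stay abstract so as to cover both [indexed_root] and the roots attached to the
    walk. *)
Hypotheses (r1p : forall i i' j, r1 (i, j) ^+ p1 = r1 (i', j) ^+ p1)
           (r2p : forall x x' y, r2 (x, y) ^+ p2 = r2 (x', y) ^+ p2).

(** The quotient [r1 a / r1 a' = r2 b' / r2 b] has order dividing the coprime numbers [p1 ^ k1] and
    [p2 ^ k2], hence equals [1]. *)
Lemma prod_unity_root_inj :
  injective (fun a : (I1 * J1) * (I2 * J2) => r1 a.1 * r2 a.2).
Proof.
have p1k : (0 < p1 ^ k1)%N by rewrite expn_gt0 prime_gt0.
have p2k : (0 < p2 ^ k2)%N by rewrite expn_gt0 prime_gt0.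
have r10 a : r1 a != 0 by apply: unity_root_neq0 p1k _.
have r20 a : r2 a != 0 by apply: unity_root_neq0 p2k _.
have cop : coprime (p1 ^ k1) (p2 ^ k2).
  by rewrite coprimeXl // coprimeXr // prime_coprime // dvdn_prime2.
move=> [a b] [a' b'] /= E.
have E' : r1 a / r1 a' = r2 b' / r2 b.
  by apply/eqP; rewrite eqr_div // E mulrC.
have w1 : (r1 a / r1 a') ^+ (p1 ^ k1) = 1.
  by rewrite exprMn exprVn !r1q divr1.
have w2 : (r1 a / r1 a') ^+ (p2 ^ k2) = 1.
  by rewrite E' exprMn exprVn !r2q divr1.
have w : r1 a / r1 a' = 1.
  (* Bezout: [kn * p1 ^ k1 = km * p2 ^ k2 + 1]. *)
  case: (egcdnP (p2 ^ k2) p1k) => kn km km_eq _.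
  move: km_eq; rewrite (eqP cop) => km_eq.
  have := exprD (r1 a / r1 a') (km * p2 ^ k2) 1.
  by rewrite -km_eq mulnC [(km * _)%N]mulnC !exprM w1 w2 !expr1n mul1r expr1 => <-.
have aa : a = a' by apply: r1I; rewrite -[LHS](mulfVK (r10 a')) w mul1r.
by congr (_, _) => //; apply: r2I; apply: (mulfI (r10 a)); rewrite E aa.
Qed.

(* In the Fourier expansion of the second difference of [A], the frequency [u]
   occurs with the factors [r1 (i, j) ^- u - r1 (i', j) ^- u], zero if [p1]
   divides [u], and [r2 (x, y) ^- u - r2 (x', y) ^- u], zero if [p2] does. *)
Lemma vanishing_sum_square (z : F) (A : (I1 * J1) * (I2 * J2) -> nat) :
  q.-primitive_root z -> \sum_a (r1 a.1 * r2 a.2) *+ A a = 0 ->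
  forall i i' j x x' y,
    (A ((i, j), (x, y)) + A ((i', j), (x', y)) =
     A ((i', j), (x, y)) + A ((i, j), (x', y)))%N.
Proof.
move=> zP sA i i' j x x' y; have q0 := prim_order_gt0 zP.
pose r (a : (I1 * J1) * (I2 * J2)) := r1 a.1 * r2 a.2.
have rq a : r a ^+ q = 1.
  by rewrite exprMn exprM r1q mulnC exprM r2q !expr1n mulr1.
(* The Fourier transform of [A]; [hat 1] is the given vanishing sum. *)
pose hat u := \sum_a (A a)%:R * r a ^+ u.
have inv b : (A b)%:R *+ q = \sum_(u < q) hat u * (r b)^-1 ^+ u :> F.
  exact: (@fourier_inversion _ q _ r (fun a => (A a)%:R)) prod_unity_root_inj rq q0.
have hat0 u : coprime u q -> hat u = 0.
  move=> uq; rewrite -[RHS](@vanishing_sum_conj _ _ _ _ A r u zP rq uq sA).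
  by apply: eq_bigr => a _; rewrite mulr_natl.
have pV (T U : finType) (s : T * U -> F) p : prime p ->
    (forall i i' j, s (i, j) ^+ p = s (i', j) ^+ p) ->
    forall i i' j u, ~~ coprime p u -> (s (i, j))^-1 ^+ u = (s (i', j))^-1 ^+ u.
  move=> pP sp t t' w u; rewrite prime_coprime // negbK => /dvdnP[v ->].
  by rewrite mulnC !exprVn !exprM (sp t t').
apply/eqP; rewrite -(eqr_nat F) !natrD -subr_eq0.
(* Multiplying by [q], harmless in characteristic zero, lets the inversion formula be
   substituted. *)
suff : ((A ((i, j), (x, y)))%:R + (A ((i', j), (x', y)))%:R -
     ((A ((i', j), (x, y)))%:R + (A ((i, j), (x', y)))%:R)) *+ q == 0 :> F.
  by rewrite mulrn_eq0 gtn_eqF.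
rewrite mulrnBl !mulrnDl !inv -!big_split /= -sumrB big1 // => u _.
rewrite -!mulrDr -mulrBr.
have [uq|] := boolP (coprime u q); first by rewrite hat0 // mul0r.
rewrite coprimeMr negb_and => /orP[] uq.
  have {}uq : ~~ coprime p1 u by apply: contra uq => h; rewrite coprimeXr // coprime_sym.
  rewrite /r /= !invfM !exprMn (pV _ _ _ _ p1P r1p i' i j u uq).
  by rewrite subrr mulr0.
have {}uq : ~~ coprime p2 u by apply: contra uq => h; rewrite coprimeXr // coprime_sym.
rewrite /r /= !invfM !exprMn (pV _ _ _ _ p2P r2p x' x y u uq).
by rewrite [X in _ - X]addrC subrr mulr0.
Qed.

(** For the converse, [A] splits into a part independent of [i] and a part independent of [x]; each
    sums to zero over its free coset. *)
Lemma vanishing_sumP (z : F) (A : (I1 * J1) * (I2 * J2) -> nat) :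
  q.-primitive_root z ->
  (forall j, \sum_i r1 (i, j) = 0) -> (forall y, \sum_x r2 (x, y) = 0) ->
  \sum_a (r1 a.1 * r2 a.2) *+ A a = 0 <->
  forall i i' j x x' y,
    (A ((i, j), (x, y)) + A ((i', j), (x', y)) =
     A ((i', j), (x, y)) + A ((i, j), (x', y)))%N.
Proof.
move=> zP s1 s2; split=> [|sq]; first exact: vanishing_sum_square zP.
have [i0 _|I10] := pickP I1; last by rewrite big1 // => -[[i ? ] ?]; have := I10 i.
have [x0 _|I20] := pickP I2; last by rewrite big1 // => -[? [x ?]]; have := I20 x.
(* The square with corner [(i0, x0)] gives the splitting; signs do not matter, since it takes place
   in [F]. *)
transitivity (\sum_a (r1 a.1 * r2 a.2) *
  ((A ((i0, a.1.2), a.2))%:R + ((A (a.1, (x0, a.2.2)))%:R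
    - (A ((i0, a.1.2), (x0, a.2.2)))%:R))).
  apply: eq_bigr => -[[i j] [x y]] _ /=; rewrite -mulr_natr; congr (_ * _).
  by rewrite addrA -natrD -(sq i i0 j x x0 y) natrD addrK.
under eq_bigr do rewrite mulrDr; rewrite big_split /=.
rewrite -(pair_bigA _ (fun a b => r1 a * r2 b * (A ((i0, a.2), b))%:R)) /=.
rewrite exchange_big /= [X in X + _]big1 => [|b _]; last first.
  under eq_bigr do rewrite -mulrA.
  exact: (sum_mul_snd0 (fun j => r2 b * (A (i0, j, b))%:R) s1).
rewrite add0r -(pair_bigA _ (fun a b => r1 a * r2 b *
  ((A (a, (x0, b.2)))%:R - (A ((i0, a.2), (x0, b.2)))%:R))) /=.
rewrite big1 // => a _; under eq_bigr do rewrite [r1 a * _]mulrC -mulrA.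
exact: (sum_mul_snd0 (fun y => r1 a * ((A (a, (x0, y)))%:R - (A (i0, a.2, (x0, y)))%:R)) s2).
Qed.
End TwoPrimes.

Lemma square_decomposable (p1 k1 p2 k2 : nat) (A : mult_matrix p1 k1 p2 k2) :
  decomposable A <->
  forall i i' j x x' y,
    (A ((i, j), (x, y)) + A ((i', j), (x', y)) =
     A ((i', j), (x, y)) + A ((i, j), (x', y)))%N.
Proof.
split=> [[B [C AE]] i i' j x x' y|sq]; first by rewrite !AE; lia.
have [x0 _|I20] := pickP 'I_p2; last first.
  by exists (fun _ _ _ => 0%N), (fun _ _ _ => 0%N) => i j x; have := I20 x.
have [i0 _|I10] := pickP 'I_p1; last first.
  by exists (fun _ _ _ => 0%N), (fun _ _ _ => 0%N) => i; have := I10 i.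
(* Subtracting the minimum over [x] keeps [C] nonnegative, so that the truncated subtraction is
   exact. *)
pose m j y := [arg min_(x < x0) A ((i0, j), (x, y))]%N.
exists (fun i j y => A ((i, j), (m j y, y))).
exists (fun j x y => A ((i0, j), (x, y)) - A ((i0, j), (m j y, y)))%N.
move=> i j x y; have := sq i i0 j x (m j y) y.
have : (A ((i0, j), (m j y, y)) <= A ((i0, j), (x, y)))%N.
  by rewrite /m; case: arg_minnP => // x1 _; apply.
by move: (A _) (A _) (A _) (A _); lia.
Qed.

(** The [n] distinct values of [r] already exhaust the at most [n] roots of [X^n - 1]. *)
Lemma unity_root_index (F : fieldType) n (T : finType) (r : T -> F) w :
  (0 < n)%N -> #|T| = n -> injective r -> (forall a, r a ^+ n = 1) ->
  w ^+ n = 1 -> exists a, w = r a.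
Proof.
move=> n0 Tn rI rn wn.
have [/codomP[a ->]|wr] := boolP (w \in codom r); first by exists a.
have := @max_unity_roots F n (w :: codom r) n0.
rewrite /= wr (map_inj_uniq rI) enum_uniq size_codom Tn ltnn.
have -> : all n.-unity_root (codom r).
  by apply/allP => _ /codomP[a ->]; apply/unity_rootP; rewrite rn.
have -> : n.-unity_root w by apply/unity_rootP.
by move=> /(_ isT isT).
Qed.

Lemma sum_fibers (V : nmodType) (I T : finType) (s : I -> T) (f : T -> V) :
  \sum_c f (s c) = \sum_a f a *+ #|[set c | s c == a]%SET|.
Proof.
rewrite (partition_big s xpredT) //=; apply: eq_bigr => a _.
rewrite (eq_bigr (fun=> f a)) => [|c /eqP-> //].
by rewrite sumr_const; congr (_ *+ _); apply: eq_card => c; rewrite !inE.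
Qed.

(** * Complex exponentials and the roots [indexed_root] *)

Section Roots.
Variable R : realType.
Implicit Types t : R.

Lemma expiD t t' : expi (t + t') = expi t * expi t'.
Proof. by rewrite /expi cosD sinD; congr (_ +i* _); rewrite addrC mulrC [X in _ + X]mulrC. Qed.

Lemma expi0 : expi (0 : R) = 1.
Proof. by rewrite /expi cos0 sin0. Qed.

Lemma expiMn t n : expi (t *+ n) = expi t ^+ n.
Proof. by elim: n => [|n IHn]; rewrite ?expi0 // mulrS exprS expiD IHn. Qed.

Lemma expi2pi : expi (2 * pi : R) = 1.
Proof. by rewrite mulr_natl /expi cos2pi sin2pi. Qed.

(** Since [cos t = 1 - 2 sin^2 (t / 2)], the value [1] would force [sin (t / 2) = 0], while
    [0 < t / 2 < pi]. *)
Lemma expi_neq1 t : 0 < t < 2 * pi -> expi t != 1.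
Proof.
move=> /andP[t0 t2]; apply/negP => /eqP[c1 _].
have : 0 < sin (t / 2) by rewrite sin_gt0_pi // divr_gt0 //= ltr_pdivrMr // mulrC.
have := cos_mulr2n (t / 2).
rewrite -[t / 2 *+ 2]mulr_natr divfK // c1 cos2sin2 => /eqP.
rewrite -subr_eq0 mulrnBl opprB addrA.
have -> : 1 + 1 - (1 *+ 2 - sin (t / 2) ^+ 2 *+ 2) = sin (t / 2) ^+ 2 *+ 2 :> R.
  by rewrite opprB addrCA -mulr2n subrr addr0.
by rewrite mulrn_eq0 expf_eq0 /= => /eqP->; rewrite ltxx.
Qed.

Lemma expi_prim n : (0 < n)%N -> n.-primitive_root (expi (2 * pi / n%:R : R)).
Proof.
move=> n0; rewrite /primitive_root_of_unity n0; apply/forallP => i.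
have n0R : 0 < n%:R :> R by rewrite ltr0n.
rewrite unity_rootE -expiMn; apply/eqP.
have [->|ni] := eqVneq i.+1 n.
  by rewrite -[_ / _ *+ n]mulr_natr divfK ?lt0r_neq0 // expi2pi eqxx.
have pi20 : 0 < 2 * pi :> R by rewrite mulr_gt0 ?pi_gt0.
apply/negbTE/expi_neq1; rewrite -[_ / _ *+ _]mulr_natr -mulrA pmulr_rgt0 //.
rewrite mulr_gt0 ?invr_gt0 ?ltr0n //= gtr_pMr // mulrC ltr_pdivrMr // mul1r.
by rewrite ltr_nat ltn_neqAle ni ltn_ord.
Qed.

Section IndexedRoot.
Variables (p k : nat).
Hypotheses (p0 : (0 < p)%N) (k0 : (0 < k)%N).
Local Notation z := (expi (2 * pi / (p ^ k)%:R : R)).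
Let pk0 : (0 < p ^ k)%N. Proof. by rewrite expn_gt0 p0. Qed.
Let zP : (p ^ k).-primitive_root z. Proof. exact: expi_prim. Qed.
Let pkE : (p ^ k = p ^ k.-1 * p)%N. Proof. by rewrite -expnSr prednK. Qed.

Lemma indexed_rootE a :
  @indexed_root R p k a = z ^+ (a.2 + p ^ k.-1 * a.1) :> R[i].
Proof.
by case: a => i j; rewrite /indexed_root -expiMn -[_ / _ *+ _]mulr_natr mulrAC.
Qed.

Lemma indexed_root_expr a : @indexed_root R p k a ^+ (p ^ k) = 1 :> R[i].
Proof. by rewrite indexed_rootE exprAC (prim_expr_order zP) expr1n. Qed.

(** The exponents are below [p ^ k], and [i], [j] are their quotient and remainder by [p ^ k.-1]. *)
Lemma indexed_root_inj : injective (@indexed_root R p k).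
Proof.
move=> [i j] [i' j'] /eqP; rewrite !indexed_rootE /=.
have lt (a : 'I_p) (b : 'I_(p ^ k.-1)) : (b + p ^ k.-1 * a < p ^ k)%N.
  by rewrite pkE; have := ltn_ord a; have := ltn_ord b; nia.
rewrite (eq_prim_root_expr zP) !modn_small ?lt // => /eqP E.
have E2 : j = j' :> nat.
  have := congr1 (fun m => m %% p ^ k.-1)%N E.
  by rewrite /= ![(_ * nat_of_ord _)%N]mulnC ![(nat_of_ord _ + _)%N]addnC !modnMDl !modn_small.
congr (_, _); apply/val_inj => //=.
move/eqP: E; rewrite E2 eqn_add2l eqn_pmul2l ?expn_gt0 ?p0 // => /eqP; exact.
Qed.

(** The index [i] contributes [p ^ k.-1 * i] to the exponent, which becomes a multiple of
    [p ^ k]. *)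
Lemma indexed_root_expp i i' j :
  @indexed_root R p k (i, j) ^+ p = @indexed_root R p k (i', j) ^+ p :> R[i].
Proof.
rewrite !indexed_rootE /= !exprD !exprM !exprMn -!exprM ![(_ * p)%N]mulnC.
by rewrite !mulnA ![(p * _)%N]mulnC -pkE !exprM (prim_expr_order zP) !expr1n.
Qed.

(** A geometric sum whose ratio [z ^+ (p ^ k.-1)] is a nontrivial [p]-th root of unity. *)
Lemma sum_indexed_root j : (1 < p)%N -> \sum_i @indexed_root R p k (i, j) = 0 :> R[i].
Proof.
move=> p1; under eq_bigr do rewrite indexed_rootE /= exprD exprM.
rewrite -mulr_sumr sum_expr_unity ?mulr0 // -?exprM -?pkE ?(prim_expr_order zP) //.
rewrite -(prim_order_dvd zP) gtnNdvd ?expn_gt0 ?p0 // ltn_exp2l //.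
by rewrite prednK.
Qed.
End IndexedRoot.
End Roots.

(** * Classification *)

Lemma ord2P (k : 'I_2) : k = ord0 \/ k = ord_max.
Proof. by case: k => -[|[|//]] lt; [left|right]; apply: val_inj. Qed.

Lemma conj_unity_root (C : numClosedFieldType) n (w : C) :
  (0 < n)%N -> w ^+ n = 1 -> Num.conj w = w^-1.
Proof.
move=> n0 wn; have w1 : `|w| = 1.
  by apply/eqP; rewrite -(pexpr_eq1 n0) // -normrX wn normr1.
by rewrite invC_norm w1 expr1n invr1 mul1r.
Qed.

Lemma root_matrixP (R : realType) q M N (H : 'M[R[i]]_(M, N)) :
  root_matrix q H <-> forall i c, H i c ^+ q = 1.
Proof.
split=> [/mxOverP Hq i c|Hq]; first exact/unity_rootP/Hq.
by apply/mxOverP => i c; apply/unity_rootP.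
Qed.

(** The two ordered pairs of distinct rows give conjugate sums, so one of them suffices. *)
Lemma partial_butson2P (R : realType) q N (H : 'M[R[i]]_(2, N)) :
  root_matrix q H ->
  partial_butson q H <-> \sum_c H ord_max c * Num.conj (H ord0 c) = 0.
Proof.
have dotE i i' : dotmx (row i H) (row i' H) = \sum_c H i c * Num.conj (H i' c).
  by rewrite dotmxE mxE; apply: eq_bigr => c _; rewrite !mxE.
move=> Hq; split=> [[_ /(_ ord_max ord0 isT)]|H0]; first by rewrite dotE.
split=> // i i'; rewrite dotE.
case: (ord2P i) (ord2P i') => -> [] ->; rewrite ?eqxx // => _.
apply: (inv_inj (@conjCK _)); rewrite rmorph0 -[RHS]H0 rmorph_sum.
by apply: eq_bigr => c _; rewrite rmorphM /= conjCK mulrC.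
Qed.

Lemma partial_butson_dephased (R : realType) q N (H : 'M[R[i]]_(2, N)) :
  root_matrix q H -> dephased H ->
  partial_butson q H <-> \sum_c H ord_max c = 0.
Proof.
move=> Hq Hd; rewrite partial_butson2P //.
by under eq_bigr do rewrite Hd rmorph1 mulr1.
Qed.

(** * Sequences of columns and their fiber sizes *)

Lemma count_mem_fiber N (T : finType) (s : 'I_N -> T) a :
  count_mem a [seq s c | c <- enum 'I_N] = #|[set c | s c == a]%SET|.
Proof.
rewrite count_map -sum1_count -sum1_card big_enum_cond /=.
by apply: eq_bigl => c; rewrite !inE.
Qed.

(** Equal fiber sizes make the tuples of values permutations of each other. *)
Lemma perm_fibers N (T : finType) (s s' : 'I_N -> T) :
  (forall a, #|[set c | s c == a]%SET| = #|[set c | s' c == a]%SET|) ->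
  exists u : 'S_N, forall c, s' c = s (u c).
Proof.
move=> ss'; have /tuple_permP[u /val_inj E] :
    perm_eq [tuple s' c | c < N] [tuple s c | c < N].
  by apply/allP => a _ /=; rewrite !count_mem_fiber ss'.
by exists u => c; have := congr1 (fun t => tnth t c) E; rewrite !tnth_mktuple.
Qed.

Lemma exists_fibers N (T : finType) (A : T -> nat) : (\sum_a A a)%N = N ->
  exists s : 'I_N -> T, forall a, #|[set c | s c == a]%SET| = A a.
Proof.
(* The witness lists each [a] exactly [A a] times. *)
move=> AN; pose t := flatten [seq nseq (A a) a | a <- enum T].
have tN : size t == N.
  apply/eqP; rewrite size_flatten sumnE /shape /t 2!big_map -[RHS]AN big_enum /=.
  by apply: eq_bigr => a _; rewrite size_nseq.
exists (tnth (Tuple tN)) => a; rewrite -count_mem_fiber map_tnth_enum /=.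
rewrite count_flatten sumnE /t 2!big_map big_enum /= (bigD1 a) //= count_nseq /= eqxx mul1n.
rewrite big1 ?addn0 // => b ba.
by rewrite count_nseq /= (negbTE ba).
Qed.

(** * Dephased matrices and their multiplicity matrices *)

Section Classification.
Variables (R : realType) (p1 p2 k1 k2 N : nat).
Hypotheses (p1P : prime p1) (p2P : prime p2) (p12 : p1 <> p2).
Hypotheses (k10 : (1 <= k1)%N) (k20 : (1 <= k2)%N).
Local Notation q := (p1 ^ k1 * p2 ^ k2)%N.
Local Notation index := (('I_p1 * 'I_(p1 ^ k1.-1)) * ('I_p2 * 'I_(p2 ^ k2.-1)))%type.
Implicit Types (H : 'M[R[i]]_(2, N)) (a : index).

Let p10 := prime_gt0 p1P.
Let p20 := prime_gt0 p2P.
Let q0 : (0 < q)%N. Proof. by rewrite muln_gt0 !expn_gt0 p10 p20. Qed.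
Let p12' : p1 != p2. Proof. exact/eqP. Qed.

Definition root_of_index a : R[i] := indexed_root R a.1 * indexed_root R a.2.

Lemma root_of_index_inj : injective root_of_index.
Proof.
apply: (@prod_unity_root_inj _ p1 p2 k1 k2) => //.
- exact: indexed_root_inj.
- exact: indexed_root_inj.
- exact: indexed_root_expr.
- exact: indexed_root_expr.
Qed.

Lemma root_of_index_expr a : root_of_index a ^+ q = 1.
Proof.
rewrite exprMn exprM indexed_root_expr ?prime_gt0 // expr1n mul1r.
by rewrite mulnC exprM indexed_root_expr ?prime_gt0 // expr1n.
Qed.

Lemma root_matrix_index H : root_matrix q H ->
  exists s : 'I_N -> index, forall c, H ord_max c = root_of_index (s c).
Proof.
move=> /root_matrixP Hq; apply: (fin_all_exists (P := fun c a => H ord_max c = root_of_index a)) => c.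
apply: unity_root_index q0 _ root_of_index_inj root_of_index_expr (Hq _ _).
by rewrite !card_prod !card_ord -!expnS !prednK.
Qed.

Lemma multiplicity_fibers H (s : 'I_N -> index) a :
  (forall c, H ord_max c = root_of_index (s c)) ->
  multiplicity p1 k1 p2 k2 H a = #|[set c | s c == a]%SET|.
Proof.
move=> Hs; rewrite ffunE; apply: eq_card => c.
by rewrite !inE Hs (inj_eq root_of_index_inj).
Qed.

(** Both sides amount to the square identities: decomposability directly, orthogonality after
    grouping the columns by their root. *)
Lemma partial_butson_decomposable H : root_matrix q H -> dephased H ->
  partial_butson q H <-> decomposable (multiplicity p1 k1 p2 k2 H).
Proof.
move=> Hq Hd; rewrite partial_butson_dephased // square_decomposable.
have [s Hs] := root_matrix_index Hq.
rewrite -(@vanishing_sumP _ p1 p2 k1 k2 _ _ _ _ (@indexed_root R p1 k1)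
  (@indexed_root R p2 k2) p1P p2P p12' _ _ _ _ _ _ _
  (multiplicity p1 k1 p2 k2 H) (expi_prim R q0)).
- under eq_bigr do rewrite Hs.
  rewrite sum_fibers.
  by under eq_bigr do rewrite -(multiplicity_fibers _ Hs).
- exact: indexed_root_inj.
- exact: indexed_root_inj.
- exact: indexed_root_expr.
- exact: indexed_root_expr.
- exact: indexed_root_expp.
- exact: indexed_root_expp.
- by move=> *; apply: sum_indexed_root => //; apply: prime_gt1.
- by move=> *; apply: sum_indexed_root => //; apply: prime_gt1.
Qed.

Lemma multiplicity_sum H : root_matrix q H ->
  (\sum_a multiplicity p1 k1 p2 k2 H a)%N = N.
Proof.
move=> /root_matrix_index[s Hs].
under eq_bigr do rewrite (multiplicity_fibers _ Hs).
rewrite -[RHS]card_ord -sum1_card (partition_big s xpredT) //=.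
apply: eq_bigr => a _; rewrite -sum1_card; apply: eq_bigl => c.
by rewrite inE.
Qed.

Lemma multiplicity_indexes_classes :
  indexes_classes
    [set H : 'M[R[i]]_(2, N) | dephased H /\ partial_butson q H]
    (@column_equiv R 2 N)
    (@multiplicity R p1 k1 p2 k2 N)
    [set A : mult_matrix p1 k1 p2 k2 | decomposable A /\ (\sum_a A a)%N = N].
Proof.
split=> [H [Hd HB]|H H' [Hd HB] [Hd' HB']|A [Adec AN]].
- have Hq := HB.1.
  by split; [exact/partial_butson_decomposable|exact: multiplicity_sum].
- have [[s Hs] [s' Hs']] := (root_matrix_index HB.1, root_matrix_index HB'.1).
  split=> [[u HH']|mHH'].
    (* The fibers of [H'] are the preimages under [u] of those of [H]. *)
    apply/ffunP => a; rewrite !ffunE -(card_preimset _ (@perm_inj _ u)).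
    by apply: eq_card => c; rewrite !inE HH' mxE.
  have [|u su] := @perm_fibers _ _ s s'.
    by move=> a; rewrite -(multiplicity_fibers _ Hs) -(multiplicity_fibers _ Hs') mHH'.
  exists u; apply/matrixP => i c; rewrite mxE.
  have [->|->] := ord2P i; first by rewrite Hd Hd'.
  by rewrite Hs Hs' su.
have [s sA] := exists_fibers AN.
pose H : 'M[R[i]]_(2, N) := \matrix_(i, c) if i == ord0 then 1 else root_of_index (s c).
have Hs c : H ord_max c = root_of_index (s c) by rewrite mxE.
have Hd : dephased H by move=> c; rewrite mxE.
have Hq : root_matrix q H.
  by apply/root_matrixP => i c; rewrite mxE; case: ifP; rewrite ?expr1n ?root_of_index_expr.
have HA : multiplicity p1 k1 p2 k2 H = A.
  by apply/ffunP => a; rewrite (multiplicity_fibers _ Hs) sA.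
exists H => //; split=> //.
by apply/partial_butson_decomposable => //; rewrite HA.
Qed.
End Classification.

(** * Random walks *)

(** Sets of complex matrices are counted through an injective parametrization by a finite type. *)
Lemma card_fset_set_image (T : finType) (U : choiceType) (f : T -> U)
    (P : {pred T}) (E : set U) :
  injective f -> (forall u, E u <-> exists2 x, x \in P & f x = u) ->
  #|` fset_set E| = #|P|.
Proof.
move=> fI EP; have EE : E = [set` [fset f x | x in P]%fset].
  apply/seteqP; split=> u /=; first by move=> /EP[x xP <-]; apply/imfsetP; exists x.
  by move=> /imfsetP[x xP ->]; apply/EP; exists x.
by rewrite EE set_fsetK card_imfset // cardE.
Qed.

Section Walk.
Variables (R : realType) (p : nat).
Hypotheses (pP : prime p) (p3 : (3 <= p)%N).
Local Notation omega := (expi (2 * pi / p%:R : R)).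
Let p0 : (0 < p)%N := prime_gt0 pP.
Let omegaP : p.-primitive_root omega := expi_prim R p0.
Let p2 : 2 != p. Proof. by rewrite ltn_eqF. Qed.

(** For exponents [k1 = k2 = 1] the second indices take a single value, hence [unit]. *)
Let r1 (a : bool * unit) : R[i] := (-1) ^+ a.1.
Let r2 (a : 'I_p * unit) : R[i] := omega ^+ a.1.

Let r1I : injective r1.
Proof.
by move=> [b []] [b' []] /signr_inj /= ->.
Qed.

Let r2I : injective r2.
Proof.
move=> [x []] [x' []] /eqP; rewrite /r2 /= (eq_prim_root_expr omegaP).
by rewrite !modn_small // => /eqP/val_inj ->.
Qed.

Let r1q a : r1 a ^+ (2 ^ 1) = 1. Proof. exact: sqrr_sign. Qed.
Let r2q a : r2 a ^+ (p ^ 1) = 1.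
Proof. by rewrite expn1 exprAC (prim_expr_order omegaP) expr1n. Qed.

(** The root matched with the move [walk_step m]. *)
Definition step_root (m : bool * 'I_p) : R[i] := (-1) ^+ m.1 * omega ^+ m.2.

Let pairing (m : bool * 'I_p) := ((m.1, tt), (m.2, tt)).

Let step_rootE m : step_root m = r1 (pairing m).1 * r2 (pairing m).2.
Proof. by []. Qed.

Lemma step_root_inj : injective step_root.
Proof.
move=> [b x] [b' x'].
rewrite !step_rootE => /(@prod_unity_root_inj _ 2 p 1 1 _ _ _ _ r1 r2 isT pP p2 r1I r2I r1q r2q).
by case=> -> ->.
Qed.

Lemma step_root_expr m : step_root m ^+ (2 * p) = 1.
Proof.
rewrite exprMn exprM sqrr_sign expr1n mul1r exprAC mulnC exprM.
by rewrite (prim_expr_order omegaP) !expr1n.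
Qed.

(** The endpoint has coordinates [c (false, x) - c (true, x)], and the square identities say that
    these do not depend on [x]. *)
Lemma sum_step_root_eq0 N (s : 'I_N -> bool * 'I_p) :
  \sum_t step_root (s t) = 0 <-> diagonal_points (\sum_t walk_step (s t)).
Proof.
pose c m := #|[set t | s t == m]%SET|.
pose A (a : (bool * unit) * ('I_p * unit)) := c (a.1.1, a.2.1).
have -> : \sum_t step_root (s t) = \sum_a (r1 a.1 * r2 a.2) *+ A a.
  rewrite (sum_fibers s) (reindex pairing) //=.
  by exists (fun a => (a.1.1, a.2.1)) => [[]|[[? []] [? []]]].
have walkE x : (\sum_t walk_step (s t)) 0 x = (c (false, x))%:Z - (c (true, x))%:Z.
  rewrite (sum_fibers s) summxE.
  rewrite -(pair_bigA _ (fun b y => (walk_step (b, y) *+ c (b, y)) 0 x)) /=.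
  rewrite big_bool /= addrC; congr (_ + _).
    rewrite (bigD1 x) //= big1 ?addr0 => [|y yx].
      by rewrite mulmxnE !mxE /= !eqxx expr0 mul1r natz.
    by rewrite mulmxnE !mxE /= [x == y]eq_sym (negbTE yx) mulr0 mul0rn.
  rewrite (bigD1 x) //= big1 ?addr0 => [|y yx].
    by rewrite mulmxnE !mxE /= !eqxx expr1 mulr1 mulNrn natz.
  by rewrite mulmxnE !mxE /= [x == y]eq_sym (negbTE yx) mulr0 mul0rn.
have qP : (2 ^ 1 * p ^ 1).-primitive_root (expi (2 * pi / (2 ^ 1 * p ^ 1)%:R : R)).
  by apply: expi_prim; rewrite muln_gt0 !expn1.
rewrite (@vanishing_sumP _ 2 p 1 1 _ _ _ _ r1 r2 isT pP p2 r1I r2I r1q r2q _ _ _ A qP).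
(* Squares with equal signs are trivial; those with opposite signs compare the coordinates [x] and
   [x']. *)
- split=> [sq|[v vE] [] [] [] x x' []]; last 4 first.
  + by rewrite addnC.
  + have := walkE x; have := walkE x'; rewrite vE !mxE /A /=; lia.
  + have := walkE x; have := walkE x'; rewrite vE !mxE /A /=; lia.
  + by rewrite addnC.
  (* The common value is read off at coordinate [0]. *)
  exists ((c (false, Ordinal p0))%:Z - (c (true, Ordinal p0))%:Z).
  apply/rowP => x; rewrite walkE mxE.
  by have := sq false true tt x (Ordinal p0) tt; rewrite /A /=; lia.
- by move=> i i' []; rewrite /r1 !sqrr_sign.
- by move=> x x' []; rewrite (r2q (x, tt)) (r2q (x', tt)).
- by move=> []; rewrite big_bool /r1 /= expr0 expr1 addNr.
- move=> []; rewrite /r2 /= sum_expr_unity ?(prim_expr_order omegaP) //.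
  by rewrite -[omega]expr1 -(prim_order_dvd omegaP) gtnNdvd // prime_gt1.
Qed.

(* Parametrizing the second row by its quotient [fg.2] with the first one makes
   the scalar product of the rows depend on [fg.2] only. *)
Definition step_matrix N (fg : {ffun 'I_N -> bool * 'I_p} * {ffun 'I_N -> bool * 'I_p}) :
    'M[R[i]]_(2, N) :=
  \matrix_(i, t) if i == ord0 then step_root (fg.1 t)
                 else step_root (fg.1 t) * step_root (fg.2 t).

Let step_root_neq0 m : step_root m != 0.
Proof. by apply: unity_root_neq0 (step_root_expr m); rewrite muln_gt0. Qed.

Lemma step_matrix_inj N : injective (@step_matrix N).
Proof.
move=> [f g] [f' g'] /matrixP E.
have E1 : f = f'.
  apply/ffunP => t; apply: step_root_inj.
  by have := E ord0 t; rewrite !mxE.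
congr (_, _) => //; apply/ffunP => t; apply: step_root_inj.
by have := E ord_max t; rewrite !mxE /= -E1 => /mulfI; apply.
Qed.

Lemma root_matrix_step_matrix N (H : 'M[R[i]]_(2, N)) :
  root_matrix (2 * p) H <-> exists fg, step_matrix fg = H.
Proof.
rewrite root_matrixP; split=> [Hq|[fg <-] i t]; last first.
  by rewrite mxE; case: ifP => _; [|rewrite exprMn]; rewrite !step_root_expr ?mulr1.
have idx w : w ^+ (2 * p) = 1 -> exists m, w = step_root m.
  apply: unity_root_index step_root_inj step_root_expr; first by rewrite muln_gt0.
  by rewrite card_prod card_bool card_ord.
have /fin_all_exists[f Hf] t := idx _ (Hq ord0 t).
have /fin_all_exists[g Hg] t : exists m, H ord_max t / H ord0 t = step_root m.
  by apply: idx; rewrite exprMn exprVn !Hq divr1.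
exists (finfun f, finfun g); apply/matrixP => i t; rewrite !mxE !ffunE -Hf -Hg.
by have [->|->] := ord2P i; rewrite //= mulrC divfK // Hf.
Qed.

Lemma partial_butson_step_matrix N (fg : {ffun 'I_N -> bool * 'I_p} * {ffun 'I_N -> bool * 'I_p}) :
  partial_butson (2 * p) (step_matrix fg) <->
  diagonal_points (\sum_t walk_step (fg.2 t)).
Proof.
have Hq : root_matrix (2 * p) (step_matrix fg).
  by rewrite root_matrix_step_matrix; exists fg.
rewrite partial_butson2P // -sum_step_root_eq0.
under eq_bigr => t _.
  (* Conjugation inverts the entries of the first row, so each term reduces to
     [step_root (fg.2 t)]. *)
  rewrite !mxE /= (conj_unity_root _ (step_root_expr _)) ?muln_gt0 //.
  rewrite mulrC mulKf //; over.
by [].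
Qed.

Lemma uniform_proba_walk N :
  uniform_proba R (@root_matrix R (2 * p) 2 N) (@partial_butson R (2 * p) 2 N) =
  walk_proba R N (@diagonal_points p).
Proof.
pose D := [pred s : {ffun 'I_N -> bool * 'I_p} | (\sum_t walk_step (s t)) \in @diagonal_points p].
have cT : #|{ffun 'I_N -> bool * 'I_p}| = ((2 * p) ^ N)%N.
  by rewrite card_ffun card_prod card_bool !card_ord.
rewrite /uniform_proba /walk_proba.
rewrite (@card_fset_set_image _ _ _ [predX predT & D] _ (@step_matrix_inj N)); last first.
  move=> H; split=> [[/root_matrix_step_matrix[fg <-]]|[fg + <-]].
    by rewrite partial_butson_step_matrix => Dfg; exists fg; rewrite // inE.
  rewrite inE => Dfg.
  by split; [apply/root_matrix_step_matrix; exists fg | apply/partial_butson_step_matrix].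
rewrite (@card_fset_set_image _ _ _ predT _ (@step_matrix_inj N)); last first.
  move=> H; rewrite root_matrix_step_matrix.
  by split=> [[fg <-]|[fg _ <-]]; exists fg.
(* The free first row contributes [(2 * p) ^ N] to both counts and cancels. *)
rewrite cardX !card_prod !cT ![in LHS]natrM invfM mulrACA divff ?mul1r; last first.
  by rewrite pnatr_eq0 -lt0n expn_gt0 muln_gt0 p0.
under eq_bigr do rewrite prodr_const card_ord exprVn -natrX.
by rewrite sumr_const mulr_natl; congr (_ *+ _); apply: eq_card => s; rewrite !inE.
Qed.
End Walk.

Theorem theoremB (R : realType) :
  (forall p1 p2 k1 k2 N : nat,
      prime p1 -> prime p2 -> p1 <> p2 ->
      (1 <= k1)%N -> (1 <= k2)%N -> (1 <= N)%N ->
      let q := (p1 ^ k1 * p2 ^ k2)%N in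
      (forall H : 'M[R[i]]_(2, N), root_matrix q H -> dephased H ->
         (partial_butson q H <->
          decomposable (multiplicity p1 k1 p2 k2 H))) /\
      indexes_classes
        [set H : 'M[R[i]]_(2, N) | dephased H /\ partial_butson q H]
        (@column_equiv R 2 N)
        (@multiplicity R p1 k1 p2 k2 N)
        [set A : mult_matrix p1 k1 p2 k2 |
           decomposable A /\ (\sum_a A a)%N = N])
  /\
  (forall p N : nat, prime p -> (3 <= p)%N -> (1 <= N)%N ->
      let q := (2 * p)%N in
      uniform_proba R (@root_matrix R q 2 N) (@partial_butson R q 2 N) =
      walk_proba R N (@diagonal_points p)).
Proof.
split=> [p1 p2 k1 k2 N p1P p2P p12 k10 k20 _ q|p N pP p3 _ q].
  split=> [H|]; first exact: partial_butson_decomposable.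
  exact: multiplicity_indexes_classes.
exact: uniform_proba_walk.
Qed.
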